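(* Let $\Delta$ be a set of continuous derivations of $\mathcal{A}$ and let $\mathcal{C}=\ker_{\mathcal{F}}\Delta$. Suppose $f\in\mathcal{A}_+\setminus\ker\Delta$ and $1=c_0,c_1,\dots,c_n\in\ker\Delta$ are linearly independent over $\mathbb{Q}$. Then $\operatorname{Log} f,\ f=f^{c_0},\ f^{c_1},\dots,f^{c_n}$ are algebraically independent over $\mathcal{C}$.
   Context: $\mathbb{N}=\{1,2,3,\dots\}$. An arithmetic function is a function $f:\mathbb{N}\to\mathbb{C}$. $\mathcal{A}$ is the commutative $\mathbb{C}$-algebra of arithmetic functions under pointwise addition and convolution $(f*g)(n)=\sum_{d\mid n}f(d)g(n/d)$; $\alpha\in\mathbb{C}$ is identified with the function $1\mapsto\alpha$, $n\mapsto 0$ for $n>1$. $\mathcal{A}$ is an integral domain; $\mathcal{F}$ is its field of fractions. For $f\ne 0$ the order $v(f)$ is the least $n$ with $f(n)\neq 0$, and $v(0)=\infty$. $\|f\|=1/v(f)$ (with $1/\infty=0$) is a non-archimedean norm on $\mathcal{A}$, giving a metric $\|f-g\|$ and hence a topology on $\mathcal{A}$. A derivation of $\mathcal{A}$ is a $\mathbb{C}$-linear map $D:\mathcal{A}\to\mathcal{A}$ with $D(f*g)=Df*g+f*Dg$; it is continuous if it is continuous for this topology. $D$ also denotes its unique extension to $\mathcal{F}$. For a set $\Delta$ of derivations, $\ker\Delta=\{x\in\mathcal{A}:Dx=0\ \forall D\in\Delta\}$ and $\ker_{\mathcal{F}}\Delta=\{x\in\mathcal{F}:Dx=0\ \forall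 D\in\Delta\}$, a subfield of $\mathcal{F}$ containing $\mathbb{C}$ (for $\Delta=\emptyset$ these are $\mathcal{A}$ and $\mathcal{F}$). If $f(1)=0$, $\operatorname{Exp}(f)=\sum_{k\ge0}f^k/k!$ (convolution powers; convergent in the topology on $\mathcal{A}$ induced by the norm $\|\cdot\|$); in general $\operatorname{Exp}(f)=\exp(f(1))*\operatorname{Exp}(f-f(1))$. Let $\mathcal{A}_{\mathbb{R}}=\{f\in\mathcal A:f(1)\in\mathbb{R}\}$ and $\mathcal{A}_+=\{f\in\mathcal A:f(1)\in\mathbb{R},\,f(1)>0\}$. $\operatorname{Exp}$ restricts to a group isomorphism $(\mathcal{A}_{\mathbb{R}},+)\to(\mathcal{A}_+,* )$, whose inverse is denoted $\operatorname{Log}$. For $f\in\mathcal{A}_+$ and $g\in\mathcal{A}$, $f^g:=\operatorname{Exp}(g*\operatorname{Log} f)$. *)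

(* Defs.v *)
From HB Require Import structures.
From mathcomp Require Import all_boot all_order all_algebra.
From mathcomp Require Import fraction complex ring.
From mathcomp Require Import boolp classical_sets functions reals topology.
From mathcomp Require Import normedtype sequences exp trigo.
(* The notations of mpoly clash with those of mathcomp-analysis. *)
From mathcomp Require Import -(notations) mpoly.

Set Implicit Arguments.
Unset Strict Implicit.
Unset Printing Implicit Defensive.

Import Order.TTheory GRing.Theory Num.Theory.

Local Open Scope classical_set_scope.
Local Open Scope ring_scope.
Local Open Scope complex_scope.
Local Open Scope quotient_scope.

(* An arithmetic function is indexed by nat, with the junk value 0 at 0, so that
   f n is its value at n for every n >= 1 and equality is equality on n >= 1. *)
Record arith (R : realType) := Arith { afun :> nat -> R[i]; _ : afun 0%N == 0 }.

HB.instance Definition _ (R : realType) := [isSub for @afun R].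
HB.instance Definition _ (R : realType) := gen_eqMixin (arith R).
HB.instance Definition _ (R : realType) := gen_choiceMixin (arith R).

Section ArithRing.
Variable R : realType.
Local Notation C := R[i].
Local Notation A := (arith R).
Implicit Types (f g h : A) (a b : C) (n : nat).

Lemma arith0 f : f 0%N = 0. Proof. by case: f => f /= /eqP. Qed.

Lemma arithP f g : (forall n, (0 < n)%N -> f n = g n) -> f = g.
Proof.
move=> fg; apply: val_inj; apply/funext => -[|n]; last exact: fg.
by rewrite /= !arith0.
Qed.

Fact azero_subproof : (fun _ : nat => 0 : C) 0%N == 0. Proof. by []. Qed.
Definition azero : A := Arith azero_subproof.

Fact aopp_subproof f : (fun n => - f n) 0%N == 0.
Proof. by rewrite /= arith0 oppr0. Qed.
Definition aopp f : A := Arith (aopp_subproof f).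

Fact aadd_subproof f g : (fun n => f n + g n) 0%N == 0.
Proof. by rewrite /= !arith0 addr0. Qed.
Definition aadd f g : A := Arith (aadd_subproof f g).

Fact ascale_subproof a f : (fun n => a * f n) 0%N == 0.
Proof. by rewrite /= arith0 mulr0. Qed.
Definition ascale a f : A := Arith (ascale_subproof a f).

Fact aone_subproof : (fun n => (n == 1%N)%:R : C) 0%N == 0. Proof. by []. Qed.
Definition aone : A := Arith aone_subproof.

Fact amul_subproof f g :
  (fun n => \sum_(d <- divisors n) f d * g (n %/ d)%N) 0%N == 0.
Proof. by rewrite /= big1// => d _; rewrite div0n arith0 mulr0. Qed.
Definition amul f g : A := Arith (amul_subproof f g).

Fact aaddA : associative aadd.
Proof. by move=> f g h; apply: arithP => n _ /=; rewrite addrA. Qed.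
Fact aaddC : commutative aadd.
Proof. by move=> f g; apply: arithP => n _ /=; rewrite addrC. Qed.
Fact aadd0 : left_id azero aadd.
Proof. by move=> f; apply: arithP => n _ /=; rewrite add0r. Qed.
Fact aaddN : left_inverse azero aopp aadd.
Proof. by move=> f; apply: arithP => n _ /=; rewrite addNr. Qed.

HB.instance Definition _ := GRing.isZmodule.Build A aaddA aaddC aadd0 aaddN.

Lemma aaddE f g n : (f + g) n = f n + g n. Proof. by []. Qed.
Lemma aoppE f n : (- f) n = - f n. Proof. by []. Qed.
Lemma asubE f g n : (f - g) n = f n - g n. Proof. by []. Qed.
Lemma azeroE n : (0 : A) n = 0. Proof. by []. Qed.

Lemma amul_divE f g n N : (0 < n <= N)%N ->
  amul f g n = \sum_(i < N.+1 | (i %| n)%N) f i * g (n %/ i)%N.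
Proof.
case/andP=> n0 nN; rewrite /=.
rewrite -(big_mkord (fun i => i %| n)%N (fun i => f i * g (n %/ i)%N)).
rewrite -[RHS]big_filter.
apply: perm_big; apply: uniq_perm; rewrite ?divisors_uniq ?filter_uniq//.
  exact: iota_uniq.
move=> d; rewrite mem_filter -dvdn_divisors// mem_index_iota/=.
case: (boolP (d %| n)%N) => //= dn.
by rewrite ltnS (leq_trans (dvdn_leq n0 dn)).
Qed.

Lemma amulE f g n N : (0 < n <= N)%N ->
  amul f g n =
  \sum_(i < N.+1) \sum_(j < N.+1 | (i * j == n)%N) f i * g j.
Proof.
move=> nN; rewrite (amul_divE _ _ nN) big_mkcond/=.
case/andP: nN => n0 nN; apply: eq_bigr => i _.
case: ifPn => [in_|nin]; last first.
  rewrite big1// => j /eqP ijn; move: nin.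
  by rewrite -ijn dvdn_mulr.
have lt_q : (n %/ i < N.+1)%N by rewrite ltnS (leq_trans (leq_div _ _)).
have i0 : (0 < i)%N by exact: dvdn_gt0 in_.
rewrite (big_pred1 (Ordinal lt_q))// => j.
apply/eqP/eqP => [ijn|->/=]; last by rewrite mulnC divnK.
by apply: val_inj; rewrite /= -ijn mulKn.
Qed.

Fact amulC : commutative amul.
Proof.
move=> f g; apply: arithP => n n0.
have nn : (0 < n <= n)%N by rewrite n0 leqnn.
rewrite !(amulE _ _ nn) (exchange_big_dep xpredT)//=.
apply: eq_bigr => i _; apply: eq_big => [j|j _]; first by rewrite mulnC.
by rewrite mulrC.
Qed.

Lemma amul3E f g h n N : (0 < n <= N)%N ->
  amul f (amul g h) n =
  \sum_(i < N.+1) \sum_(k < N.+1) \sum_(l < N.+1 | (i * (k * l) == n)%N)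
     f i * (g k * h l).
Proof.
move=> nN; rewrite (amulE _ _ nN); case/andP: nN => n0 nN.
apply: eq_bigr => i _.
transitivity (\sum_(j < N.+1 | (i * j == n)%N) \sum_(k < N.+1)
    \sum_(l < N.+1 | (k * l == j)%N) f i * (g k * h l)).
  apply: eq_bigr => j /eqP ijn.
  have j0 : (0 < j <= N)%N.
    rewrite -[(j <= N)%N]ltnS ltn_ord andbT lt0n; apply: contraTneq n0 => j0.
    by rewrite -ijn j0 muln0.
  rewrite (amulE _ _ j0) big_distrr/=; apply: eq_bigr => k _.
  by rewrite big_distrr.
rewrite exchange_big/=; apply: eq_bigr => k _.
rewrite (exchange_big_dep xpredT)//= [RHS]big_mkcond/=; apply: eq_bigr => l _.
case: ifPn => [/eqP e|ne]; last first.
  rewrite big1// => j /andP[/eqP ijn /eqP klj]; move: ne.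
  by rewrite klj ijn eqxx.
have lt_kl : (k * l < N.+1)%N.
  rewrite ltnS (leq_trans _ nN)// dvdn_leq// -e; exact: dvdn_mull.
rewrite (big_pred1 (Ordinal lt_kl))// => j /=.
apply/andP/eqP => [[_ /eqP klj]|->/=]; first exact: val_inj.
by rewrite e !eqxx.
Qed.

Fact amulA : associative amul.
Proof.
move=> f g h; rewrite [RHS]amulC; apply: arithP => n n0.
have nn : (0 < n <= n)%N by rewrite n0 leqnn.
rewrite !(amul3E _ _ _ nn); rewrite [RHS]exchange_big/=; apply: eq_bigr => i _.
rewrite [RHS](exchange_big_dep xpredT)//=; apply: eq_bigr => k _.
apply: eq_big => [l|l _]; first by rewrite [in RHS]mulnC -mulnA.
by rewrite [RHS]mulrC mulrA.
Qed.

Fact amul1 : left_id aone amul.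
Proof.
move=> f; apply: arithP => n n0.
have nn : (0 < n <= n)%N by rewrite n0 leqnn.
rewrite (amul_divE _ _ nn).
have l1 : (1 < n.+1)%N by rewrite ltnS.
rewrite (bigD1 (Ordinal l1)) ?dvd1n//= mul1r divn1 big1 ?addr0// => i.
by case/andP => _ /negPf i1; rewrite -val_eqE/= in i1; rewrite /= i1 mul0r.
Qed.

Fact amulDl : left_distributive amul aadd.
Proof.
move=> f g h; apply: arithP => n n0 /=; rewrite -big_split/=.
by apply: eq_bigr => d _; rewrite mulrDl.
Qed.

Fact aone_neq0 : aone != 0.
Proof.
by apply/eqP => /(congr1 (fun f : A => f 1%N)) /eqP; rewrite /= oner_eq0.
Qed.

HB.instance Definition _ :=
  GRing.Zmodule_isComNzRing.Build A amulA amulC amul1 amulDl aone_neq0.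

Fact ascaleA a b f : ascale a (ascale b f) = ascale (a * b) f.
Proof. by apply: arithP => n _ /=; rewrite mulrA. Qed.
Fact ascale1 : left_id 1 ascale.
Proof. by move=> f; apply: arithP => n _ /=; rewrite mul1r. Qed.
Fact ascaleDr : right_distributive ascale +%R.
Proof. by move=> a f g; apply: arithP => n _ /=; rewrite mulrDr. Qed.
Fact ascaleDl f : {morph ascale^~ f : a b / a + b}.
Proof. by move=> a b; apply: arithP => n _ /=; rewrite mulrDl. Qed.

HB.instance Definition _ :=
  GRing.Zmodule_isLmodule.Build C A ascaleA ascale1 ascaleDr ascaleDl.

Fact ascaleAl a f g : a *: (f * g) = (a *: f) * g.
Proof.
apply: arithP => n n0 /=; rewrite big_distrr/=; apply: eq_bigr => d _.
by rewrite mulrA.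
Qed.

HB.instance Definition _ := GRing.Lmodule_isLalgebra.Build C A ascaleAl.

Fact ascaleAr a f g : a *: (f * g) = f * (a *: g).
Proof. by rewrite [f * g]mulrC ascaleAl mulrC. Qed.

HB.instance Definition _ := GRing.Lalgebra_isAlgebra.Build C A ascaleAr.

Definition aunit : {pred A} := fun f => `[< exists g, g * f = 1 >].
Definition ainv f : A := xget f [set g | g * f = 1].

Fact amulVr : {in aunit, left_inverse 1 ainv *%R}.
Proof.
move=> f /asboolP[g gf]; rewrite /ainv.
by case: xgetP => [_ -> //|/(_ g)].
Qed.
Fact aunitPl f g : g * f = 1 -> f \in aunit.
Proof. by move=> gf; apply/asboolP; exists g. Qed.
Fact ainv_out : {in [predC aunit], ainv =1 id}.
Proof.
move=> f /asboolP nf; rewrite /ainv; case: xgetP => // g _ gf.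
by case: nf; exists g.
Qed.

HB.instance Definition _ :=
  GRing.ComNzRing_hasMulInverse.Build A amulVr aunitPl ainv_out.

Lemma arith_neq0 f : f != 0 -> exists n, f n != 0.
Proof.
move=> /eqP f0; apply: contrapT => /forallNP H; apply: f0.
by apply: arithP => n _; have /negP/negPn/eqP := H n.
Qed.

Fact arith_idomain f g : f * g = 0 -> (f == 0) || (g == 0).
Proof.
move=> fg0; apply: contraPT fg0; rewrite negb_or => /andP[f0 g0].
have exf := arith_neq0 f0; have exg := arith_neq0 g0.
case: (ex_minnP exf) => n fn minn_.
case: (ex_minnP exg) => m gm minm.
have n0 : (0 < n)%N.
  by rewrite lt0n; apply: contraNneq fn => ->; rewrite arith0.
have m0 : (0 < m)%N.
  by rewrite lt0n; apply: contraNneq gm => ->; rewrite arith0.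
move=> /(congr1 (fun h : A => h (n * m)%N)); rewrite azeroE.
have nm : (0 < n * m <= n * m)%N by rewrite muln_gt0 n0 m0 leqnn.
rewrite (_ : (f * g) _ = amul f g (n * m)%N)// (amul_divE _ _ nm).
have ln : (n < (n * m).+1)%N by rewrite ltnS leq_pmulr.
rewrite (bigD1 (Ordinal ln)) ?dvdn_mulr//= mulKn// big1 ?addr0.
  by move/eqP; rewrite mulf_eq0 (negPf fn) (negPf gm).
move=> i /andP[inm]; rewrite -val_eqE/= => i_n.
have i0 : (0 < i)%N by apply: dvdn_gt0 inm; case/andP: nm.
apply/eqP; rewrite mulf_eq0; apply/orP.
case: (ltngtP i n) => [lt_in|lt_ni|e]; last by rewrite e eqxx in i_n.
  by left; apply: contraTT lt_in => /minn_; rewrite leqNgt.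
right; apply: contraLR lt_ni => /minm; rewrite -leqNgt leq_divRL// => h.
by rewrite -(leq_pmul2l m0) [(m * n)%N]mulnC.
Qed.

HB.instance Definition _ := GRing.ComUnitRing_isIntegral.Build A arith_idomain.

End ArithRing.

Section ArithTopology.
Variable R : realType.
Local Notation A := (arith R).
Implicit Types f g h : A.

(* None stands for the value oo taken at 0. *)
Definition aord f : option nat :=
  if pselect (exists n, f n != 0) is left ex then Some (ex_minn ex) else None.

Definition anorm f : R := if aord f is Some n then n%:R^-1 else 0.

Variant anorm_spec f : R -> Prop :=
  | AnormZero of f = 0 : anorm_spec f 0
  | AnormOrd n of (0 < n)%N & f n != 0 & (forall m, (m < n)%N -> f m = 0) :
      anorm_spec f n%:R^-1.

Lemma anormP f : anorm_spec f (anorm f).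
Proof.
rewrite /anorm /aord; case: pselect => [ex|nex]; last first.
  constructor; apply/eqP; apply: contra_notT nex; exact: arith_neq0.
case: ex_minnP => n fn minn_; constructor => //.
  by rewrite lt0n; apply: contraNneq fn => ->; rewrite arith0.
move=> m mn; apply/eqP; apply: contraTT mn => /minn_.
by rewrite -leqNgt.
Qed.

Lemma anorm_ge0 f : 0 <= anorm f.
Proof. by case: anormP => // n _ _ _; rewrite invr_ge0 ler0n. Qed.

Lemma anorm_ge f n : f n != 0 -> n%:R^-1 <= anorm f.
Proof.
move=> fn; case: anormP => [f0|m m0 _ minm].
  by rewrite f0 azeroE eqxx in fn.
have mn : (m <= n)%N.
  by rewrite leqNgt; apply: contra fn => /minm ->.
by rewrite lef_pV2 ?posrE ?ltr0n ?ler_nat// (leq_trans m0).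
Qed.

Lemma anorm0 : anorm 0 = 0.
Proof. by case: anormP => // n _; rewrite azeroE eqxx. Qed.

Lemma anorm_eq0 f : anorm f = 0 -> f = 0.
Proof.
case: anormP => // n n0 _ _ /eqP.
by rewrite invr_eq0 pnatr_eq0 => /eqP n1; rewrite n1 in n0.
Qed.

Lemma anormN f : anorm (- f) = anorm f.
Proof.
have le g : anorm (- g) <= anorm g.
  case: (anormP (- g)) => [_|n _ gn _]; first exact: anorm_ge0.
  by apply: anorm_ge; rewrite aoppE oppr_eq0 in gn.
by apply/eqP; rewrite eq_le le -{1}[f]opprK le.
Qed.

Lemma anorm_ultra f g : anorm (f + g) <= Num.max (anorm f) (anorm g).
Proof.
rewrite le_max; case: (anormP (f + g)) => [_|n n0 fgn _].
  by rewrite anorm_ge0.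
have [fn|/anorm_ge -> //] := eqVneq (f n) 0.
by move: fgn; rewrite aaddE fn add0r => /anorm_ge ->; rewrite orbT.
Qed.

Definition adist f g : R := anorm (f - g).

Fact adistxx f : adist f f = 0.
Proof. by rewrite /adist subrr anorm0. Qed.
Fact adist_positivity f g : adist f g = 0 -> f = g.
Proof. by move/anorm_eq0/eqP; rewrite subr_eq0 => /eqP. Qed.
Fact adist_sym f g : adist f g = adist g f.
Proof. by rewrite /adist -anormN opprB. Qed.
Fact adist_triangle g f h : adist f h <= adist f g + adist g h.
Proof.
rewrite /adist -[f - h](subrKA g) (le_trans (anorm_ultra _ _))//.
by rewrite ge_max lerDl lerDr !anorm_ge0.
Qed.

HB.instance Definition _ :=
  isMetric.Build R A adistxx adist_positivity adist_sym adist_triangle.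
HB.instance Definition _ := isPointed.Build A 0.

End ArithTopology.

Section Exponential.
Variable R : realType.
Local Notation C := R[i].
Local Notation A := (arith R).

Definition expC (z : C) : C :=
  (expR (complex.Re z))%:C *
  (cos (complex.Im z) +i* sin (complex.Im z)).

(* Only used at f such that f 1 = 0, where the series converges. *)
Definition Exp0 (f : A) : A :=
  limn (series (fun k => (k`!%:R^-1 : C) *: f ^+ k)).

Definition Exp (f : A) : A := (expC (f 1%N))%:A * Exp0 (f - (f 1%N)%:A).

Definition arith_real : set A := [set f | f 1%N \is Num.real].
Definition arith_pos : set A := [set f | f 1%N \is Num.real /\ 0 < f 1%N].

(* The inverse of Exp : arith_real -> arith_pos; junk outside arith_pos. *)
Definition Log (f : A) : A := xget 0 (arith_real `&` [set g | Exp g = f]).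

Definition apow (f g : A) : A := Exp (g * Log f).

End Exponential.

Arguments arith_real R : clear implicits.
Arguments arith_pos R : clear implicits.

Section Derivations.
Variable R : realType.
Local Notation A := (arith R).
Local Notation F := {fraction A}.
Local Notation "x %:F" := (tofrac x).

Definition derivation (D : A -> A) : Prop :=
  linear D /\ forall f g : A, D (f * g) = D f * g + f * D g.

Definition frac_ext (D : A -> A) (x : F) : F :=
  let r := repr x in
  (D \n_r * \d_r - \n_r * D \d_r)%:F / (\d_r ^+ 2)%:F.

Lemma fracE (x : F) : x = (\n_(repr x))%:F / (\d_(repr x))%:F.
Proof.
have d0 : \d_(repr x) != 0 by exact: denom_ratioP.
apply: (canRL (mulfK _)); first by rewrite tofrac_eq0.
rewrite -{1}[x]reprK; move: (repr x) d0 => r d0; unlock tofrac.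
rewrite -[LHS]FracField.pi_mul /FracField.mulf !numden_Ratio ?oner_neq0//.
apply/eqmodP; rewrite /= /FracField.equivf.
by rewrite !numden_Ratio ?oner_neq0 ?mulr1// mulrC.
Qed.

Lemma frac_extE D f g : derivation D -> g != 0 ->
  frac_ext D (f%:F / g%:F) = (D f * g - f * D g)%:F / (g ^+ 2)%:F.
Proof.
move=> [_ DM] g0; rewrite /frac_ext.
have := fracE (f%:F / g%:F); move: (repr _) => r.
have d0 : \d_r != 0 by exact: denom_ratioP.
move/eqP; rewrite eqr_div ?tofrac_eq0// -!tofracM tofrac_eq => /eqP e.
apply/eqP; rewrite eqr_div ?tofrac_eq0 ?expf_neq0// -!tofracM tofrac_eq.
have De := congr1 D e; rewrite !DM in De.
apply/eqP; move: (\n_r) (\d_r) (D \n_r) (D \d_r) e De => n d Dn Dd e De.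
transitivity ((Dn * g + n * D g) * (d * g) - (n * g) * (g * Dd + d * D g)).
  by ring.
by rewrite -De -e; ring.
Qed.

Lemma fracW (x : F) : exists f g, g != 0 /\ x = f%:F / g%:F.
Proof.
exists \n_(repr x), \d_(repr x); split; [exact: denom_ratioP|exact: fracE].
Qed.

(* frac_ext D is the unique derivation of the fraction field extending D. *)
Lemma frac_ext_tofrac D f : derivation D -> frac_ext D f%:F = (D f)%:F.
Proof.
move=> der; have [_ DM] := der.
have D1 : D 1 = 0.
  have := DM 1 1; rewrite !mulr1 mul1r => /eqP.
  by rewrite eq_sym -subr_eq0 addrK => /eqP.
have -> : f%:F = f%:F / 1%:F by rewrite tofrac1 divr1.
by rewrite frac_extE ?oner_neq0// D1 mulr0 subr0 mulr1 expr1n tofrac1 divr1.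
Qed.

Lemma frac_extD D x y : derivation D ->
  frac_ext D (x + y) = frac_ext D x + frac_ext D y.
Proof.
move=> der; have [Dlin DM] := der.
have DD f g : D (f + g) = D f + D g by have := Dlin 1 f g; rewrite !scale1r.
have [a [b [b0 ->]]] := fracW x; have [c [d [d0 ->]]] := fracW y.
rewrite addf_div ?tofrac_eq0// -!tofracM -tofracD !frac_extE ?mulf_neq0//.
rewrite addf_div ?tofrac_eq0 ?expf_neq0// -!tofracM -tofracD.
congr (_%:F / _%:F); last by ring.
by rewrite DD !DM; ring.
Qed.

Lemma frac_extM D x y : derivation D ->
  frac_ext D (x * y) = frac_ext D x * y + x * frac_ext D y.
Proof.
move=> der; have [Dlin DM] := der.
have [a [b [b0 ->]]] := fracW x; have [c [d [d0 ->]]] := fracW y.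
rewrite mulf_div -!tofracM !frac_extE ?mulf_neq0// !mulf_div -!tofracM.
rewrite addf_div ?tofrac_eq0 ?mulf_neq0 ?expf_neq0// -!tofracM -tofracD.
apply/eqP; rewrite eqr_div ?tofrac_eq0 ?mulf_neq0 ?expf_neq0 ?mulf_neq0//.
by rewrite -!tofracM tofrac_eq; apply/eqP; rewrite !DM; ring.
Qed.

Lemma frac_ext_unique D (E : F -> F) : derivation D ->
  (forall f, E f%:F = (D f)%:F) ->
  (forall x y, E (x * y) = E x * y + x * E y) -> E =1 frac_ext D.
Proof.
move=> der ED EM x; have [a [b [b0 ->]]] := fracW x.
have bF : b%:F != 0 by rewrite tofrac_eq0.
apply: (mulIf bF); apply: (@addIr _ (a%:F / b%:F * (D b)%:F)).
rewrite -{1}ED -EM divfK// ED -(frac_ext_tofrac b der) -frac_extM// divfK//.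
by rewrite frac_ext_tofrac.
Qed.

Definition kerA (Delta : set (A -> A)) : set A :=
  [set f | forall D, Delta D -> D f = 0].

Definition kerF (Delta : set (A -> A)) : set F :=
  [set x | forall D, Delta D -> frac_ext D x = 0].

End Derivations.

Definition alg_independent (F : fieldType) (K : set F) (n : nat)
    (x : 'I_n -> F) : Prop :=
  forall p : mpoly n F, p \is a mpolyOver n (mem K) -> meval x p = 0 -> p = 0.

Definition Q_independent (R : realType) (n : nat) (c : 'I_n -> arith R) : Prop :=
  forall q : 'I_n -> rat,
    \sum_(i < n) (ratr (q i) : R[i]) *: c i = 0 -> forall i, q i = 0.

(* Main.v *)
Require Import Defs.
From mathcomp Require Import all_boot all_order all_algebra fraction complex.
From mathcomp Require Import ring.
From mathcomp Require Import boolp classical_sets reals topology.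
From mathcomp Require Import sequences exp trigo.
From mathcomp Require Import -(notations) mpoly.

(** Write [L] for [Log f] and pick [D] in [Delta] with [D f != 0].  A continuous
    derivation satisfies [D (Exp g) = D g * Exp g], so [D f = D L * f] and
    hence [D L != 0].  On the fraction field, let [d] be [D] divided by [D L].
    This is again a derivation; it kills the constants of [Delta], and

      [d L = 1],   [d (f^c_i) = c_i * f^c_i],

    so [L] behaves as the variable [t] and [f^c_i] as [exp (c_i t)].  What
    remains is the classical independence of exponential polynomials
    ([exponential_poly_independent], [alg_independent_exponentials]): a
    polynomial relation between [L] and the [f^c_i], once sorted by the
    monomial in the [f^c_i], reads [\sum_r q_r(L) * Y_r = 0], where the [q_r]
    have constant coefficients and [d Y_r = e_r * Y_r] with
    [e_r = \sum_i r_i c_i].  Independence of the [c_i] over the rationals makes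
    the exponents [e_r] pairwise distinct.  The operator [d - e_s] sends
    [q_r(L) * Y_r] to [(q_r' + (e_r - e_s) q_r)(L) * Y_r]: it keeps the degree
    of every nonzero coefficient except that of [Y_s], whose degree it lowers, and an
    induction on the sizes of the coefficients forces all of them to vanish.

    The chain rule for [Exp] comes from termwise differentiation of a power
    series in [h] with [h 1 = 0] ([derivation_pseries]).  The topology enters
    only through [nbhs_agreeP]: being close to [f] means having the same values
    as [f] up to a large index.  At every fixed index the series is a finite sum,
    as [h ^+ k] vanishes at all [n <= k].

    That [Exp] reaches [f], so that [Log f] really is a logarithm, is obtained
    from a differential equation as well ([Exp0_onto]).  The derivation
    [f n |-> ln n * f n] kills only the scalars and is invertible on functions
    vanishing at 1, so the equation [dlog h = dlog f / f] has a solution [h] with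
    [h 1 = 0]; then [Exp h / f] has derivative 0 and value 1 at 1. *)

Set Implicit Arguments.
Unset Strict Implicit.
Unset Printing Implicit Defensive.

Import Order.TTheory GRing.Theory Num.Theory.

Local Open Scope classical_set_scope.
Local Open Scope ring_scope.

(** * Derivations of commutative rings *)

Section DifferentialRing.
Variables (K : comNzRingType) (d : K -> K).
Hypothesis dD : {morph d : x y / x + y}.
Hypothesis dM : forall x y, d (x * y) = d x * y + x * d y.

Lemma der0 : d 0 = 0.
Proof. by apply: (addrI (d 0)); rewrite -dD !addr0. Qed.

Lemma der1 : d 1 = 0.
Proof. by apply: (addrI (d 1)); rewrite -{3}[1]mulr1 dM mulr1 mul1r addr0. Qed.

Lemma der_sum I (s : seq I) (P : pred I) (F : I -> K) :
  d (\sum_(i <- s | P i) F i) = \sum_(i <- s | P i) d (F i).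
Proof. exact: (big_morph d dD der0). Qed.

Lemma der_mulrn x k : d (x *+ k) = d x *+ k.
Proof. by elim: k => [|k IHk]; rewrite ?der0// !mulrS dD IHk. Qed.

Lemma der_opp x : d (- x) = - d x.
Proof. by apply: (addrI (d x)); rewrite -dD !subrr der0. Qed.

Lemma der_horner (q : {poly K}) x : (forall j, d q`_j = 0) ->
  d q.[x] = q^`().[x] * d x.
Proof.
elim/poly_ind: q => [|q c IHq] dq; first by rewrite deriv0 !horner0 der0 mul0r.
have dq' j : d q`_j = 0.
  by have := dq j.+1; rewrite coefD coefMX coefC /= addr0.
have dc : d c = 0 by have := dq 0%N; rewrite coefD coefMX coefC /= add0r.
rewrite derivMXaddC !hornerE dD dM (IHq dq') dc addr0 /=; ring.
Qed.

Lemma der_exp y k : d (y ^+ k.+1) = d y * y ^+ k *+ k.+1.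
Proof.
elim: k => [|k IHk]; first by rewrite expr1 expr0 mulr1.
by rewrite exprS dM IHk [RHS]mulrS exprS; ring.
Qed.

Lemma der_exp_scale y e k : d y = e * y -> d (y ^+ k) = e *+ k * y ^+ k.
Proof.
case: k => [|k] dy; first by rewrite expr0 der1 mulr0n mul0r.
by rewrite der_exp dy -mulrA -exprS mulrnAl.
Qed.

(** Monomials in eigenvectors of a derivation are eigenvectors, and the
    eigenvalues add up: the algebraic form of [exp a * exp b = exp (a + b)]. *)
Lemma der_prod_scale n (y e : 'I_n -> K) (r : 'I_n -> nat) :
  (forall i, d (y i) = e i * y i) ->
  d (\prod_i y i ^+ r i) = (\sum_i e i *+ r i) * \prod_i y i ^+ r i.
Proof.
move=> dy; elim/big_ind2: _ => [|p a q b dp dq|i _].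
- by rewrite der1 mul0r.
- by rewrite dM dp dq; ring.
- exact: der_exp_scale.
Qed.

End DifferentialRing.

(** * Independence of exponential polynomials over a differential field *)

Section DifferentialField.
Variables (K : fieldType) (d : K -> K).
Hypothesis charK : forall n, n.+1%:R != 0 :> K.
Hypothesis dD : {morph d : x y / x + y}.
Hypothesis dM : forall x y, d (x * y) = d x * y + x * d y.

Let d0 := der0 dD.
Let d1 := der1 dM.

Lemma deriv_eq0_polyC (q : {poly K}) : q^`() = 0 -> q = (q`_0)%:P.
Proof.
move=> q'0; apply/polyP => -[|j]; rewrite coefC//=; apply/eqP.
have /polyP/(_ j)/eqP := q'0; rewrite coef_deriv coef0 -mulr_natr mulf_eq0.
by rewrite (negPf (charK j)) orbF.
Qed.

Lemma size_deriv_scale_le (q : {poly K}) (e : K) :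
  (size (q^`() + e *: q)%R <= size q)%N.
Proof.
rewrite (leq_trans (size_polyD _ _))// geq_max size_scale_leq andbT.
have [->|q0] := eqVneq q 0; first by rewrite deriv0.
exact: ltnW (lt_size_deriv q0).
Qed.

(** With [x] as the variable [t] and [Y i] as [exp (e i * t)], exponential
    polynomials with distinct exponents and constant coefficients are linearly
    independent.  Applying [d - e i0] to a relation strictly shrinks the
    coefficient of [Y i0] and enlarges no other one, so by induction every
    coefficient of the new relation is zero; this kills the old coefficients
    away from [i0] and makes the one at [i0] constant. *)
Lemma exponential_poly_independent (I : eqType) (x : K) (Y e : I -> K)
    (s : seq I) (q : I -> {poly K}) :
  d x = 1 -> (forall i, Y i != 0) -> (forall i, d (Y i) = e i * Y i) ->
  (forall i, d (e i) = 0) -> injective e -> uniq s ->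
  (forall i j, d (q i)`_j = 0) ->
  \sum_(i <- s) (q i).[x] * Y i = 0 -> {in s, forall i, q i = 0}.
Proof.
move=> dx Y0 dY de einj us.
have [N] := ubnP (\sum_(i <- s) size (q i))%N; elim: N q => // N IHN q.
rewrite ltnS => leN dq sum0 i0 i0s; apply/eqP/negPn/negP => q0.
(* the coefficients of the relation obtained by applying [d - e i0] *)
pose q' k := (q k)^`() + (e k - e i0) *: q k.
have dq' k j : d (q' k)`_j = 0.
  rewrite coefD coefZ coef_deriv dD (der_mulrn dD) dM !dq mul0rn mulr0.
  by rewrite dD (der_opp dD) !de subrr mul0r !addr0.
have lt_q'0 : (size (q' i0) < size (q i0))%N.
  by rewrite /q' subrr scale0r addr0 lt_size_deriv.
have sum'0 : \sum_(k <- s) (q' k).[x] * Y k = 0.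
  have := congr1 d sum0; rewrite (der_sum dD) d0.
  rewrite -[RHS](mulr0 (e i0)) -[in RHS]sum0 => /eqP.
  rewrite -subr_eq0 mulr_sumr -sumrB => /eqP {2}<-; apply: eq_bigr => k _.
  by rewrite dM dY (der_horner dD dM)// dx /q' hornerD hornerZ; ring.
have q'0 : {in s, forall k, q' k = 0}.
  apply: IHN => //; apply: leq_trans leN.
  rewrite !(perm_big _ (perm_to_rem i0s)) !big_cons -addSn leq_add//.
  by apply: leq_sum => k _; apply: size_deriv_scale_le.
(* for k != i0 the term [(e k - e i0) *: q k] alone has the top degree *)
have qC k : k \in s -> k != i0 -> q k = 0.
  move=> ks ki; apply/eqP/negPn/negP => qk0.
  have /eqP := q'0 k ks; rewrite -size_poly_eq0.
  rewrite /q' addrC size_polyDl size_scale ?subr_eq0 ?(inj_eq einj)//.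
    by rewrite size_poly_eq0 (negPf qk0).
  exact: lt_size_deriv.
have /deriv_eq0_polyC qi0 : (q i0)^`() = 0.
  by have := q'0 i0 i0s; rewrite /q' subrr scale0r addr0.
move: sum0; rewrite (bigD1_seq i0)//= big_seq_cond big1 => [|k /andP[ks ki]].
  rewrite addr0 => /eqP; rewrite mulf_eq0 (negPf (Y0 i0)) orbF qi0 hornerC.
  by move=> /eqP e0; rewrite qi0 e0 eqxx in q0.
by rewrite qC// horner0 mul0r.
Qed.

(** A polynomial in [x] and the [y i] is an exponential polynomial: its part
    with exponent vector [r] in the [y i] has [\prod_i y i ^+ r i] as the
    exponential of [(\sum_i r i * e i) * t].  Injectivity
    on exponent vectors is independence of the [e i] over the rationals, with
    denominators cleared and negative terms moved to the other side. *)
Lemma alg_independent_exponentials (C : set K) n (x : K) (y e : 'I_n -> K) :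
  (forall a, C a -> d a = 0) -> d x = 1 -> (forall i, y i != 0) ->
  (forall i, d (y i) = e i * y i) -> (forall i, d (e i) = 0) ->
  injective (fun r : {ffun 'I_n -> nat} => \sum_i e i *+ r i) ->
  alg_independent C
    (fun i : 'I_n.+1 => if unlift ord0 i is Some j then y j else x).
Proof.
move=> dC dx y0 dy de einj p pC.
have dp m : d (mcoeff m p) = 0.
  have [ms|/memN_msupp_eq0 ->] := boolP (m \in msupp p); last exact: d0.
  apply: dC; move: pC; rewrite qualifE /= => /allP/(_ _ (map_f _ ms)).
  by rewrite inE.
pose rest (m : multinom n.+1) : {ffun 'I_n -> nat} :=
  [ffun j => m (lift ord0 j)].
pose q r : {poly K} :=
  \sum_(m <- msupp p | rest m == r) mcoeff m p *: 'X^(m ord0).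
(* [m] is determined by [rest m] and [m ord0], so no two terms collide *)
have q_coef m : (q (rest m))`_(m ord0) = mcoeff m p.
  rewrite /q coef_sum.
  have -> : \sum_(m' <- msupp p | rest m' == rest m)
      (mcoeff m' p *: 'X^(m' ord0))`_(m ord0) =
    \sum_(m' <- msupp p | m' == m) mcoeff m' p.
    rewrite big_mkcond [RHS]big_mkcond; apply: eq_bigr => m' _.
    rewrite coefZ coefXn; have [->|m'm] := eqVneq m' m.
      by rewrite !eqxx mulr1.
    case: eqP => // rm; case: eqP => [m0|_]; last by rewrite mulr0.
    case/eqP: m'm; apply/mnmP => i; case: (unliftP ord0 i) => [j|] -> //.
    by have /ffunP/(_ j) := rm; rewrite !ffunE.
  have [ms|/memN_msupp_eq0 pm] := boolP (m \in msupp p).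
    by rewrite -big_filter filter_pred1_uniq// big_seq1.
  by rewrite pm big1// => m' /eqP ->.
rewrite mevalE => sum0.
have sum_q : \sum_(r <- undup (map rest (msupp p)))
    (q r).[x] * \prod_j y j ^+ r j = 0.
  rewrite -[RHS]sum0.
  transitivity (\sum_(r <- undup (map rest (msupp p)))
    \sum_(m <- msupp p | rest m == r)
      mcoeff m p * (x ^+ m ord0 * \prod_j y j ^+ rest m j)).
    apply: eq_bigr => r _; rewrite /q horner_sum mulr_suml.
    by apply: eq_bigr => m /eqP <-; rewrite hornerZ hornerXn mulrA.
  rewrite (exchange_big_dep xpredT)//=; apply: eq_big_seq => m ms.
  have rs : rest m \in undup (map rest (msupp p)).
    by rewrite mem_undup map_f.
  rewrite -big_filter (_ : seq.filter _ _ = [:: rest m]) ?big_seq1; last first.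
    rewrite -(filter_pred1_uniq (undup_uniq _) rs).
    by apply: eq_filter => r; rewrite /= eq_sym.
  rewrite big_ord_recl unlift_none; congr (_ * (_ * _)).
  by apply: eq_bigr => j _; rewrite liftK ffunE.
apply/mpolyP => m; rewrite mcoeff0.
have [ms|/memN_msupp_eq0 //] := boolP (m \in msupp p).
have Y0 (r : {ffun 'I_n -> nat}) : \prod_j y j ^+ r j != 0.
  by apply/prodf_neq0 => j _; rewrite expf_neq0.
have de_sum (r : {ffun 'I_n -> nat}) : d (\sum_i e i *+ r i) = 0.
  by rewrite (der_sum dD) big1// => i _; rewrite (der_mulrn dD) de mul0rn.
have dq r j : d (q r)`_j = 0.
  rewrite /q coef_sum (der_sum dD) big1// => m' _.
  rewrite coefZ coefXn dM dp mul0r add0r.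
  by case: (_ == _); rewrite ?d1 ?d0 mulr0.
rewrite -q_coef (exponential_poly_independent dx Y0
  (fun r : {ffun 'I_n -> nat} => der_prod_scale dM r dy) de_sum einj
  (undup_uniq (map rest (msupp p))) dq sum_q) ?coef0//.
by rewrite mem_undup map_f.
Qed.

End DifferentialField.

(** * Coefficientwise description of the topology *)

Section ArithSeries.
Variable R : realType.
Local Notation C := R[i].
Local Notation A := (arith R).
Implicit Types (f g h : A) (a : nat -> C) (D : A -> A).

Lemma arith_mulE f g n :
  (f * g) n = \sum_(k <- divisors n) f k * g (n %/ k)%N.
Proof. by []. Qed.

Lemma arith_mul_at1 f g : (f * g) 1%N = f 1%N * g 1%N.
Proof.
by rewrite arith_mulE (_ : divisors 1 = [:: 1%N])// big_seq1 divn1.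
Qed.

Lemma arith_scaleE (z : C) f n : (z *: f) n = z * f n.
Proof. by []. Qed.

Lemma arith_algE (z : C) n : (z%:A : A) n = if n == 1%N then z else 0.
Proof.
rewrite arith_scaleE (_ : (1 : A) n = (n == 1%N)%:R)//.
by case: eqP; rewrite ?mulr1 ?mulr0.
Qed.

Lemma arith_sumE I (s : seq I) (F : I -> A) n :
  (\sum_(i <- s) F i) n = \sum_(i <- s) F i n.
Proof. exact: (big_morph (fun f : A => f n) (fun f g => erefl) erefl). Qed.

Definition agree N f g := forall k, (k <= N)%N -> f k = g k.

Lemma agreeW M N f g : (M <= N)%N -> agree N f g -> agree M f g.
Proof. by move=> MN fg k kM; apply: fg; apply: leq_trans MN. Qed.

Lemma agree_trans N f g h : agree N f g -> agree N g h -> agree N f h.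
Proof. by move=> fg gh k kN; rewrite fg// gh. Qed.

Lemma agree_eq f g : (forall N, agree N f g) -> f = g.
Proof. by move=> fg; apply: arithP => n _; apply: (fg n). Qed.

Lemma agreeM N h f g : agree N f g -> agree N (h * f) (h * g).
Proof.
move=> fg k kN; rewrite !arith_mulE; apply: eq_bigr => i _.
by rewrite fg// (leq_trans (leq_div _ _)).
Qed.

Lemma anorm_lt_inv f n : (0 < n)%N -> anorm f < n%:R^-1 <-> agree n f 0.
Proof.
move=> n0; split=> [fn k kn|f0].
  apply/eqP/negPn/negP => fk; move: fn; apply/negP; rewrite -leNgt.
  apply: le_trans (anorm_ge fk).
  have k0 : (0 < k)%N by rewrite lt0n; apply: contraNneq fk => ->; rewrite arith0.
  by rewrite lef_pV2 ?posrE ?ltr0n// ler_nat.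
case: anormP => [_|m m0 fm _]; first by rewrite invr_gt0 ltr0n.
rewrite ltf_pV2 ?posrE ?ltr0n// ltr_nat ltnNge; apply/negP => mn.
by rewrite f0// azeroE eqxx in fm.
Qed.

(** The metric topology is that of pointwise stabilisation, as [anorm] is the
    inverse of the first index with a nonzero value. *)
Lemma nbhs_agreeP f (X : set A) :
  nbhs f X <-> exists N, forall g, agree N f g -> X g.
Proof.
have distE g n : (0 < n)%N -> adist f g < n%:R^-1 <-> agree n f g.
  move=> n0; rewrite /adist anorm_lt_inv//; split=> fg k kn.
    by have := fg k kn; rewrite asubE azeroE => /eqP; rewrite subr_eq0 => /eqP.
  by rewrite asubE fg// subrr.
split=> [/nbhs_ballP[e /= e0 fX]|[N NX]].
  have e'0 : 0 <= e^-1 by rewrite invr_ge0 ltW.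
  exists (Num.bound e^-1) => g fg; apply: fX.
  have := archi_boundP e'0; case: (Num.bound _) fg => [|n] fg en.
    by have := le_lt_trans e'0 en; rewrite ltxx.
  apply: lt_trans (_ : n.+1%:R^-1 < e); first exact/distE.
  by rewrite -[e]invrK ltf_pV2 ?posrE ?invr_gt0 ?ltr0n.
apply/nbhs_ballP; exists (N.+1%:R^-1); first by rewrite /= invr_gt0 ltr0n.
by move=> g /distE fg; apply: NX; apply: agreeW (fg _).
Qed.

(** Continuity of [D], stated without the topology so that it can be checked
    directly on concrete derivations. *)
Definition stable_coefficients D := forall f N,
  exists M, forall g, agree M f g -> agree N (D f) (D g).

Lemma continuous_stable D : continuous D -> stable_coefficients D.
Proof.
move=> cD f N; have {}cD := cD f; apply/nbhs_agreeP/cD/nbhs_agreeP.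
by exists N.
Qed.

Lemma limn_agree (u : nat -> A) f :
  (forall N, exists M, forall n, (M <= n)%N -> agree N f (u n)) ->
  limn u = f.
Proof.
move=> uf; apply: cvg_lim; first exact: metric_hausdorff.
move=> X /nbhs_agreeP[N NX]; have [M uM] := uf N.
by exists M => // n /= Mn; apply: NX; apply: uM.
Qed.

(** * Power series *)

(** A nonzero term of [h ^+ k] at [n] splits [n] into [k] factors different from
    1, so [n >= 2 ^ k > k].  This makes power series in [h] finite sums at every
    index. *)
Lemma arith_exp_vanish h k n : h 1%N = 0 -> (n <= k)%N -> (h ^+ k) n = 0.
Proof.
move=> h1; elim: k n => [|k IHk] n; first by rewrite leqn0 => /eqP->.
move=> nk; have [->|n0] := posnP n; first exact: arith0.
rewrite exprS arith_mulE big_seq big1// => d.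
rewrite -dvdn_divisors// => dn.
have [d1|d1] := leqP d 1.
  have /eqP -> : d == 1%N by rewrite eqn_leq d1 (dvdn_gt0 n0).
  by rewrite h1 mul0r.
by rewrite IHk ?mulr0// -ltnS (leq_trans (ltn_Pdiv _ _)).
Qed.

Fact pseries_subproof a h :
  (fun n => \sum_(k < n) a k * (h ^+ k) n : C) 0%N == 0.
Proof. by rewrite /= big_ord0. Qed.

(** The terms with [k >= n] are cut off because they vanish at [n] whenever
    [h 1 = 0]; so this is the sum of [a k *: h ^+ k] over all [k]. *)
Definition pseries a h : A := Arith (pseries_subproof a h).

Lemma pseries_agree a h N M : h 1%N = 0 -> (N <= M)%N ->
  agree N (pseries a h) (\sum_(0 <= k < M) a k *: h ^+ k).
Proof.
move=> h1 NM n nN; rewrite arith_sumE.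
rewrite (big_cat_nat (leq0n n) (leq_trans nN NM)) [X in _ = _ + X]big_nat_cond.
rewrite [X in _ = _ + X]big1 ?addr0 => [|k /andP[/andP[nk _] _]].
  by rewrite big_mkord.
by rewrite arith_scaleE arith_exp_vanish// mulr0.
Qed.

Lemma derivationD D : derivation D -> {morph D : f g / f + g}.
Proof. by move=> [Dlin _] f g; have := Dlin 1 f g; rewrite !scale1r. Qed.

Lemma derivationZ D z f : derivation D -> D (z *: f) = z *: D f.
Proof.
move=> der; have := der.1 z f 0.
by rewrite (der0 (derivationD der)) !addr0.
Qed.

Lemma derivation_scalar D z : derivation D -> D z%:A = 0.
Proof. by move=> der; rewrite derivationZ// (der1 der.2) scaler0. Qed.

(** Continuity reduces the claim, at any given index, to a partial sum, which
    the Leibniz rule differentiates termwise. *)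
Lemma derivation_pseries D a h : derivation D -> stable_coefficients D ->
  h 1%N = 0 ->
  D (pseries a h) = D h * pseries (fun k => a k.+1 *+ k.+1) h.
Proof.
move=> der cD h1; apply: agree_eq => N.
have [M DN] := cD (pseries a h) N.
have DD := derivationD der; have D0 := der0 DD; have DM := der.2.
pose K := maxn M N.
apply: agree_trans (DN _ (pseries_agree a h1 _)) _.
  exact: leqW (leq_maxl M N).
rewrite (_ : D _ = D h * \sum_(0 <= k < K) (a k.+1 *+ k.+1) *: h ^+ k).
  apply: agreeM => n nN; apply/esym; move: nN; apply: pseries_agree => //.
  exact: leq_maxr.
rewrite big_nat_recl// DD (derivationZ _ _ der) expr0 (der1 DM) scaler0 add0r.
rewrite (big_morph D DD D0).
rewrite mulr_sumr; apply: eq_bigr => k _.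
by rewrite (derivationZ _ _ der) (der_exp DM) -scalerAr -scalerMnl -scalerMnr.
Qed.

(** * The exponential *)

Definition exp_coef k : C := k`!%:R^-1.

Lemma natC_neq0 n : n.+1%:R != 0 :> C.
Proof. by rewrite pnatr_eq0. Qed.

Lemma Exp0E h : h 1%N = 0 -> Exp0 h = pseries exp_coef h.
Proof.
move=> h1; apply: limn_agree => N; exists N => n Nn.
by rewrite /series /=; apply: pseries_agree.
Qed.

Lemma pseries_at1 a h : pseries a h 1%N = a 0%N.
Proof. by rewrite /= big_ord1 expr0 mulr1. Qed.

Lemma Exp_at1 g : Exp g 1%N = expC (g 1%N).
Proof.
have g1 : (g - (g 1%N)%:A) 1%N = 0 by rewrite asubE arith_algE eqxx subrr.
rewrite /Exp arith_mul_at1 arith_algE eqxx Exp0E// pseries_at1.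
by rewrite /exp_coef fact0 invr1 mulr1.
Qed.

Lemma expC_neq0 (z : C) : expC z != 0.
Proof.
rewrite mulf_neq0//; first by rewrite eq_complex /= eqxx andbT gt_eqF ?expR_gt0.
rewrite eq_complex /=; apply/negP => /andP[/eqP c0 /eqP s0].
by have /eqP := cos2Dsin2 (complex.Im z);
  rewrite c0 s0 expr0n addr0 eq_sym oner_eq0.
Qed.

Lemma Exp_neq0 g : Exp g != 0.
Proof.
apply: contra (expC_neq0 (g 1%N)) => /eqP g0.
by rewrite -Exp_at1 g0 azeroE.
Qed.

Lemma derivation_Exp D g : derivation D -> stable_coefficients D ->
  D (Exp g) = D g * Exp g.
Proof.
move=> der cD.
have g1 : (g - (g 1%N)%:A) 1%N = 0 by rewrite asubE arith_algE eqxx subrr.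
rewrite /Exp der.2 derivation_scalar// mul0r add0r Exp0E//.
rewrite (derivation_pseries _ der cD g1).
have -> : D (g - (g 1%N)%:A) = D g.
  rewrite (derivationD der) (der_opp (derivationD der)) derivation_scalar//.
  by rewrite subr0.
rewrite (_ : (fun k => _) = exp_coef); first by ring.
apply/funext => k; rewrite /exp_coef factS natrM invfM -[LHS]mulr_natr mulrAC.
by rewrite mulVf ?natC_neq0 ?mul1r.
Qed.

(** * Surjectivity of the exponential *)

(** The inverse of [1 - t] is the geometric series in [t]. *)
Lemma arith_inv_exists f : f 1%N = 1 -> exists g, g * f = 1.
Proof.
move=> f1; pose t := 1 - f.
have t1 : t 1%N = 0 by rewrite asubE f1 subrr.
exists (pseries (fun=> 1) t); apply: agree_eq => N n nN.
rewrite mulrC (agreeM f (pseries_agree _ t1 (leqnn N)))//.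
have -> : f * \sum_(0 <= k < N) 1 *: t ^+ k = 1 - t ^+ N.
  rewrite big_mkord -[RHS]opprB subrX1 -mulNr opprB {2}/t subKr.
  by congr (_ * _); apply: eq_bigr => k _; rewrite scale1r.
by rewrite asubE arith_exp_vanish// subr0.
Qed.

Fact logder_subproof f : (fun n => (ln (n%:R : R))%:C%C * f n) 0%N == 0.
Proof. by rewrite /= arith0 mulr0. Qed.

(** The derivation [- d/ds] of the Dirichlet series [\sum_n f n * n^(- s)]. *)
Definition log_derivation f : A := Arith (logder_subproof f).

Lemma log_derivationE f n : log_derivation f n = (ln n%:R)%:C%C * f n.
Proof. by []. Qed.

Lemma log_derivationP : derivation log_derivation.
Proof.
split=> [z f g|f g]; apply: arithP => n n0.
  by rewrite !(aaddE, arith_scaleE, log_derivationE) mulrDr mulrCA.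
rewrite aaddE log_derivationE !arith_mulE mulr_sumr -big_split.
rewrite [LHS]big_seq [RHS]big_seq; apply: eq_bigr => d.
rewrite -dvdn_divisors// => dn.
have d0 := dvdn_gt0 n0 dn.
have q0 : (0 < n %/ d)%N by rewrite divn_gt0// dvdn_leq.
rewrite -{1}(divnK dn) natrM lnM ?posrE ?ltr0n// rmorphD/=.
by ring.
Qed.

Lemma log_derivation_stable : stable_coefficients log_derivation.
Proof. by move=> f N; exists N => g fg k kN; rewrite !log_derivationE fg. Qed.

Lemma log_derivation_eq0 f : log_derivation f = 0 -> f = (f 1%N)%:A.
Proof.
move=> df; apply: arithP => n n0; rewrite arith_algE; case: eqP => [-> //|n1].
have /eqP : log_derivation f n = 0 by rewrite df.
have lt1n : (1 < n)%N.
  by rewrite ltn_neqAle n0 andbT eq_sym; apply/eqP.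
have lnn : ln (n%:R : R) != 0 by rewrite gt_eqF// ln_gt0// ltr1n.
by rewrite log_derivationE mulf_eq0 eq_complex /= eqxx andbT (negPf lnn) => /eqP.
Qed.

(** The logarithm [h] of [f] is found by integrating its logarithmic derivative
    [log_derivation f / f]: dividing the value at [n] by [ln n]. *)
Lemma Exp0_onto f : f 1%N = 1 -> exists2 h : A, h 1%N = 0 & Exp0 h = f.
Proof.
move=> f1; have [f' f'f] := arith_inv_exists f1.
have [_ DM] := log_derivationP.
(* at [n = 1] both [ln n] and its inverse are 0, which gives [h 1 = 0] *)
pose hval n : C := (ln (n%:R : R))^-1%:C%C * (log_derivation f * f') n.
have hval0 : hval 0%N == 0 by rewrite /hval arith0 mulr0.
pose h : A := Arith hval0.
have hE n : h n = (ln (n%:R : R))^-1%:C%C * (log_derivation f * f') n by [].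
have h1 : h 1%N = 0 by rewrite hE ln1 invr0 mul0r.
have dh : log_derivation h = log_derivation f * f'.
  apply: arithP => n n0; have [->|n1] := eqVneq n 1%N.
    by rewrite arith_mul_at1 !log_derivationE ln1 !mul0r.
  have lt1n : (1 < n)%N by rewrite ltn_neqAle eq_sym n1 n0.
  rewrite log_derivationE hE mulrA -rmorphM mulfV ?mul1r//.
  by rewrite gt_eqF// ln_gt0// ltr1n.
exists h => //; pose E := Exp0 h.
have E1 : E 1%N = 1 by rewrite /E Exp0E// pseries_at1 /exp_coef fact0 invr1.
have dE : log_derivation E = log_derivation h * E.
  have := derivation_Exp h log_derivationP log_derivation_stable.
  rewrite /Exp h1 scale0r subr0 (_ : expC 0 = 1) ?scale1r ?mul1r//.
  by rewrite /expC /= expR0 cos0 sin0 mul1r.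
(* [E / f] has derivative 0, hence is the scalar [(E / f) 1 = 1] *)
have Eu : E = E * f' * f by rewrite -mulrA f'f mulr1.
have du : log_derivation (E * f') * f = 0.
  have := congr1 log_derivation Eu; rewrite DM dE dh.
  rewrite -[X in _ = _ + X]mulrA [f' * _]mulrC.
  rewrite [X in X = _]mulrC -[X in X = _]add0r => /addIr.
  by move <-.
have u_cst : E * f' = 1.
  have := congr1 (fun g => g * f') du; rewrite mul0r -mulrA [f * f']mulrC.
  rewrite f'f mulr1.
  move/log_derivation_eq0 => ->.
  have f'1 : f' 1%N = 1 by have := arith_mul_at1 f' f; rewrite f'f f1 mulr1 => <-.
  by rewrite arith_mul_at1 E1 f'1 mulr1 scale1r.
by rewrite -/E Eu u_cst mul1r.
Qed.

Lemma Exp_onto f : arith_pos R f -> exists2 g : A, arith_real R g & Exp g = f.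
Proof.
move=> [freal f1_gt0].
have f1E : f 1%N = (complex.Re (f 1%N))%:C%C by rewrite RRe_real.
have re_gt0 : 0 < complex.Re (f 1%N) by move: f1_gt0; rewrite f1E ltcR.
have f10 : f 1%N != 0 by rewrite gt_eqF.
pose l : C := (ln (complex.Re (f 1%N)))%:C%C.
have [|h h1 hf] := @Exp0_onto ((f 1%N)^-1 *: f).
  by rewrite arith_scaleE mulVf.
have g1 : (l%:A + h) 1%N = l by rewrite aaddE arith_algE eqxx h1 addr0.
exists (l%:A + h).
  by change ((l%:A + h) 1%N \is Num.real); rewrite g1 complex_real.
rewrite /Exp g1 addrC addKr hf.
rewrite (_ : expC l = f 1%N).
  by rewrite -scalerAl mul1r scalerA mulfV// scale1r.
by rewrite /expC /= cos0 sin0 mulr1 lnK ?posrE.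
Qed.

Lemma LogK f : arith_pos R f -> Exp (Log f) = f.
Proof.
move=> /Exp_onto[g gR gf]; rewrite /Log.
by case: xgetP => [_ _ [_ ->]//|/(_ g)]; case.
Qed.

End ArithSeries.

(** * Algebraic independence of the powers of an arithmetic function *)

Lemma frac_arith_char0 (R : realType) n : n.+1%:R != 0 :> {fraction arith R}.
Proof.
rewrite -tofrac1 -tofracMn tofrac_eq0 -scaler_nat.
apply/eqP => /(congr1 (fun f : arith R => f 1%N)) /eqP.
by rewrite arith_algE eqxx azeroE (negPf (natC_neq0 R n)).
Qed.

Lemma Q_independent_nat (R : realType) n (c : 'I_n -> arith R) :
  Q_independent c ->
  injective (fun r : {ffun 'I_n -> nat} => \sum_i c i *+ r i).
Proof.
move=> cQ r r' rr'; apply/ffunP => i.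
have q0 : \sum_(j < n) ratr ((r j)%:R - (r' j)%:R) *: c j = 0.
  under eq_bigr => j _ do rewrite rmorphB /= !ratr_nat scalerBl !scaler_nat.
  by rewrite sumrB rr' subrr.
by have /(_ i)/eqP := cQ _ q0; rewrite subr_eq0 eqr_nat => /eqP.
Qed.

Theorem theorem3p2 (R : realType) (Delta : set (arith R -> arith R))
    (hDelta : forall D, Delta D -> derivation D /\ continuous D)
    (f : arith R) (hf : (arith_pos R `\` kerA Delta) f)
    (n : nat) (c : 'I_n.+1 -> arith R) (hc0 : c ord0 = 1)
    (hc : forall i, kerA Delta (c i)) (hcQ : Q_independent c) :
  apow f (c ord0) = f /\
  alg_independent (kerF Delta)
    (fun i : 'I_n.+2 =>
       tofrac (if unlift ord0 i is Some j then apow f (c j) else Log f)).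
Proof.
have [fpos fker] := hf.
have Lf := LogK fpos.
split; first by rewrite /apow hc0 mul1r.
have [D DDelta Df] : exists2 D, Delta D & D f <> 0.
  apply: contrapT => nD; apply: fker => D DDelta; apply: contrapT => Df.
  by apply: nD; exists D.
have [der cD] := hDelta _ DDelta.
have DExp g : D (Exp g) = D g * Exp g.
  exact: derivation_Exp der (continuous_stable cD).
have DL0 : tofrac (D (Log f)) != 0.
  rewrite tofrac_eq0; apply/eqP => DL; apply: Df.
  by rewrite -Lf DExp DL mul0r.
pose d x := frac_ext D x / tofrac (D (Log f)).
have dtofrac g : d (tofrac g) = tofrac (D g) / tofrac (D (Log f)).
  by rewrite /d frac_ext_tofrac.
have dD : {morph d : x y / x + y} by move=> x y; rewrite /d frac_extD// mulrDl.
have dM x y : d (x * y) = d x * y + x * d y.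
  by rewrite /d frac_extM//; ring.
have -> : (fun i : 'I_n.+2 =>
    tofrac (if unlift ord0 i is Some j then apow f (c j) else Log f)) =
  (fun i => if unlift ord0 i is Some j then tofrac (apow f (c j))
            else tofrac (Log f)).
  by apply/funext => i; case: unlift.
apply: (alg_independent_exponentials (@frac_arith_char0 R) dD dM
  (e := fun i => tofrac (c i))).
- by move=> a /(_ _ DDelta) Da; rewrite /d Da mul0r.
- by rewrite dtofrac mulfV.
- by move=> i; rewrite tofrac_eq0 Exp_neq0.
- move=> i; rewrite dtofrac /apow DExp der.2 hc// mul0r add0r !tofracM.
  by rewrite mulrAC mulfK.
- by move=> i; rewrite dtofrac hc// tofrac0 mul0r.
- move=> r r' /= rr'; apply: (Q_independent_nat hcQ); apply/eqP.
  rewrite -tofrac_eq !(big_morph _ (@tofracD _) (@tofrac0 _)).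
  under eq_bigr => i _ do rewrite tofracMn.
  under [eqbRHS]eq_bigr => i _ do rewrite tofracMn.
  exact/eqP.
Qed.
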